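(* Let $G=(V,E)$ be any unweighted undirected graph on $n$ vertices, let $k\ge 1$ be an integer and let $\epsilon>0$ be real. There is a subgraph $H$ of $G$ with $|E(H)| = O\!\left((k/\epsilon)^h\, n^{1+\frac{1}{2^{k+1}-1}}\right)$, where $h = \frac{3\cdot 2^{k-1}-(k+2)}{2^{k+1}-1}$ (note $h<3/4$), such that for all $u,v\in V$, $\dist_H(u,v)\le (1+\epsilon)\dist_G(u,v) + \left(\frac{(4+o(1))k}{\epsilon}\right)^{k-1}$.
   Context: Here $\dist_G$ and $\dist_H$ denote shortest-path (hop) distances in the unweighted graphs $G$ and $H$. Such an $H$ is called a $(1+\epsilon,\beta)$-spanner with $\beta=((4+o(1))k/\epsilon)^{k-1}$.
   Formalization: For k=1 the additive term is a universal constant instead of the literal 1 (false for complete bipartite graphs); the O-constant and the o(1) (as k→∞) may depend on an arbitrary upper bound for ε, since constants uniform in all ε>0 fail already for a single edge as ε→∞. *)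

(* Defs.v *)
From HB Require Import structures.
From mathcomp Require Import all_boot all_order all_algebra.
From mathcomp Require Import all_classical all_reals all_analysis.

Set Implicit Arguments.
Unset Strict Implicit.
Unset Printing Implicit Defensive.

Import Order.TTheory GRing.Theory Num.Theory.
Import numFieldNormedType.Exports.

Local Open Scope classical_set_scope.
Local Open Scope ring_scope.

Record sgraph (V : finType) := SGraph {
  adj :> rel V;
  adj_sym : symmetric adj;
  adj_irr : irreflexive adj }.

Definition edges (V : finType) (G : sgraph V) : {set {set V}} :=
  [set [set x.1; x.2] | x in [set x : V * V | G x.1 x.2]]%SET.

(* Subgraphs are spanning: distances in them are taken between all vertices. *)
Definition subgraph (V : finType) (H G : sgraph V) : Prop := subrel H G.

(* The distance is +oo when there is no path (infimum of the empty set). *)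
Definition gdist (R : realType) (V : finType) (G : sgraph V) (u v : V) : \bar R :=
  ereal_inf [set ((size p)%:R)%:E | p in [set p : seq V | path G u p /\ last u p = v]].

Definition edge_exp (R : realType) (k : nat) : R :=
  1 + 1 / (2 ^+ k.+1 - 1).

Definition h_exp (R : realType) (k : nat) : R :=
  (3 * 2 ^+ k.-1 - k.+2%:R) / (2 ^+ k.+1 - 1).

(* The additive term ((4+o(1))k/eps)^(k-1), with eta in the role of o(1) as k
   tends to infinity. The o(1) in the base hides constant factors c > 0 in
   front of the power, since c^(1/(k-1)) tends to 1. When k = 1 the base is
   raised to the power 0, and the hidden factor is the explicit constant A:
   an additive error of exactly 1 is impossible there, because a spanner of a
   complete bipartite graph with error eps d + 1, eps < 1, is the whole graph. *)
Definition additive_term (R : realType) (A : R) (eta : nat -> R) (k : nat) (eps : R) : R :=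
  if k == 1%N then A else ((4 + eta k) * k%:R / eps) ^+ k.-1.

(* Main.v *)
(* The spanner is built on a hierarchy V = V_0, V_1, ..., V_(k+1) = {} of centres, each
   sampled from the previous one. Sampling V_(i+1) with probability p from V_i leaves
   on average fewer than 1/p centres of V_i strictly closer to a given centre than
   V_(i+1) is; shortest paths of length O(m^i) to these and to the nearest centre of
   V_(i+1) are bought. At level 1 they are too expensive and are replaced by path
   buying: the edge set minimises its size plus four times the sum of the capped
   distances between such pairs of centres, which gives additive error 6.
   A path of length m^i splits into m segments of length m^(i-1). Each is either
   preserved up to the error E_(i-1), or has both ends of a middle part close to V_i.
   Joining the first and the last such vertex through their centres costs O(R_i)
   once, R_i being the distance to V_i, unless both are close to V_(i+1); hence
   E_i = m E_(i-1) + 4 R_i, that is E_k = (4k + O(1)) m^(k-1). As V_(k+1) is empty,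
   this bounds the error at distance m^k, and m of order (4k + O(1)) / eps makes it
   eps m^k. The probabilities are such that level i contributes T / 2^(i+1) edges;
   then log |V_i| doubles its distance to log T at each level up to the price of the
   path lengths, and V_(k+1) is empty once T exceeds the bound of the theorem. *)
Require Import Defs.
From HB Require Import structures.
From mathcomp Require Import all_boot all_order all_algebra.
From mathcomp Require Import all_classical all_reals all_analysis.
From mathcomp Require Import zify ring lra.

Set Implicit Arguments.
Unset Strict Implicit.
Unset Printing Implicit Defensive.

Import Order.TTheory GRing.Theory Num.Theory.
Import numFieldNormedType.Exports.

(** * Distances and edge sets *)

(** A boolean with a length bound, monotone in [n], stands in for the distance, so unconnected
    vertices need no special value. *)
Fixpoint reach (V : finType) (e : rel V) (n : nat) (x y : V) : bool :=
  if n is m.+1 then (x == y) || [exists z, e x z && reach e m z y] else x == y.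

Section Reach.
Variable V : finType.
Implicit Types (e : rel V) (x y z : V).

Lemma reachP e n x y :
  reflect (exists p, [/\ path e x p, last x p = y & size p <= n]%N) (reach e n x y).
Proof.
apply: (iffP idP).
  elim: n x => [|n IH] x /=; first by move/eqP <-; exists [::].
  case/orP => [/eqP <-|/existsP[z /andP[xz /IH[p [pp pl ps]]]]].
    by exists [::].
  by exists (z :: p); rewrite /= xz pp.
case=> p [].
elim: p n x => [|z p IH] [|n] x //= => [_ <- _|_ <- _|] //.
- by rewrite eqxx.
- case/andP => xz pp pl ps; apply/orP; right; apply/existsP; exists z.
  by rewrite xz IH.
Qed.

Lemma reach0 e n x : reach e n x x.
Proof. by case: n => [|n] /=; rewrite eqxx. Qed.

Lemma reach_leq e m n x y : (m <= n)%N -> reach e m x y -> reach e n x y.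
Proof.
move=> mn /reachP[p [pp pl ps]]; apply/reachP; exists p; split => //.
exact: leq_trans mn.
Qed.

Lemma reach_add e m n x y z :
  reach e m x y -> reach e n y z -> reach e (m + n) x z.
Proof.
move=> /reachP[p [pp pl ps]] /reachP[q [qp ql qs]].
apply/reachP; exists (p ++ q); rewrite cat_path last_cat size_cat pl pp ql.
by rewrite qp leq_add.
Qed.

Lemma reach_split e m n x z :
  reach e (m + n) x z -> exists2 y, reach e m x y & reach e n y z.
Proof.
move=> /reachP[p [pp pl ps]]; exists (last x (take m p)).
  apply/reachP; exists (take m p); rewrite size_take_min geq_minl; split=> //.
  exact: take_path.
apply/reachP; exists (drop m p).
move: pp pl; rewrite -{1 2}(cat_take_drop m p) cat_path last_cat => /andP[_ ->] ->.
by rewrite size_drop leq_subLR.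
Qed.

Lemma reach_sub e e' n x y : subrel e e' -> reach e n x y -> reach e' n x y.
Proof.
move=> ee /reachP[p [pp pl ps]]; apply/reachP; exists p; split=> //.
exact: sub_path pp.
Qed.

Lemma reach1 e x y : e x y -> reach e 1 x y.
Proof. by move=> xy; apply/orP; right; apply/existsP; exists y; rewrite xy /= eqxx. Qed.

Lemma reach_sym e n : symmetric e -> symmetric (reach e n).
Proof.
move=> es; suff H x y : reach e n x y -> reach e n y x.
  by move=> x y; apply/idP/idP; exact: H.
elim: n x y => [|n IH] x y; first by rewrite /= eq_sym.
rewrite [X in X -> _]/= => /orP[/eqP ->|]; first exact: reach0.
case/existsP => z /andP[xz /IH zy]; rewrite -addn1.
by apply: (reach_add zy); apply: reach1; rewrite es.
Qed.

(* Equal to [D.+1] when the distance exceeds [D]. *)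
Definition tdist e D x y := find (fun n => reach e n x y) (iota 0 D.+1).

Lemma tdist_le e D n x y : (n <= D)%N -> (tdist e D x y <= n)%N = reach e n x y.
Proof.
move=> nD; apply/idP/idP => [dn|r].
  have dD : (tdist e D x y < D.+1)%N by rewrite ltnS (leq_trans dn).
  have : has (fun n => reach e n x y) (iota 0 D.+1) by rewrite has_find size_iota.
  move=> /(nth_find 0); rewrite -/(tdist e D x y) nth_iota // add0n.
  exact: reach_leq.
rewrite leqNgt; apply/negP => /(before_find 0).
by rewrite nth_iota ?add0n ?r // ltnS.
Qed.

Lemma tdist_max e D x y : (tdist e D x y <= D.+1)%N.
Proof. by rewrite /tdist -[X in (_ <= X)%N](size_iota 0) find_size. Qed.

Lemma tdist_sub e e' D x y : subrel e e' -> (tdist e' D x y <= tdist e D x y)%N.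
Proof.
move=> ee; case: (leqP (tdist e D x y) D) => h.
  by rewrite tdist_le // (reach_sub ee) // -(tdist_le _ _ _ h).
by apply: leq_trans h; exact: tdist_max.
Qed.

End Reach.

(** With edges as unordered pairs, a cardinal counts each edge once and symmetry is automatic. *)
Definition spanned (V : finType) (F : {set {set V}}) : rel V :=
  fun x y => [set x; y]%SET \in F.

Section Spanned.
Variables (V : finType) (G : sgraph V).
Implicit Types (F : {set {set V}}) (x y z : V).

Lemma spanned_sym F : symmetric (spanned F).
Proof. by move=> x y; rewrite /spanned finset.setUC. Qed.

Lemma edgesE x y : ([set x; y]%SET \in edges G) = G x y.
Proof.
apply/imsetP/idP => [[[a b]]|xy]; last by exists (x, y); rewrite ?inE.
rewrite inE /= => ab /setP E.
have /orP[/eqP xa|/eqP xb] : (x == a) || (x == b) by have := E x; rewrite !inE eqxx.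
  subst a; have /orP[/eqP yx|/eqP -> //] : (y == x) || (y == b).
    by have := E y; rewrite !inE eqxx orbT.
  have := E b; rewrite !inE eqxx orbT yx orbb => /eqP bx.
  by rewrite bx adj_irr in ab.
subst b; have /orP[/eqP ->|/eqP yx] : (y == a) || (y == x).
    by have := E y; rewrite !inE eqxx orbT.
  by rewrite adj_sym.
have := E a; rewrite !inE eqxx yx orbb => /eqP ax.
by rewrite ax adj_irr in ab.
Qed.

Lemma spanned_edges F : F \subset edges G -> subrel (spanned F) G.
Proof. by move=> FG x y /(fintype.subsetP FG); rewrite edgesE. Qed.

Lemma spanned_subset F F' : F \subset F' -> subrel (spanned F) (spanned F').
Proof. by move=> FF x y /(fintype.subsetP FF). Qed.

Lemma reachG_sym n : symmetric (reach G n).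
Proof. exact/reach_sym/adj_sym. Qed.

Lemma reachF_sym F n : symmetric (reach (spanned F) n).
Proof. exact/reach_sym/spanned_sym. Qed.

Lemma reachFG F n x y : F \subset edges G -> reach (spanned F) n x y -> reach G n x y.
Proof. by move=> FG; apply/reach_sub/spanned_edges. Qed.

Lemma reachFF F F' n x y :
  F \subset F' -> reach (spanned F) n x y -> reach (spanned F') n x y.
Proof. by move=> FF; apply/reach_sub/spanned_subset. Qed.

Lemma short_path_edges n x y : reach G n x y ->
  exists F, [/\ F \subset edges G, (#|F| <= n)%N & reach (spanned F) n x y].
Proof.
elim: n x => [|n IH] x.
  by move=> /= xy; exists finset.set0; rewrite finset.sub0set cards0.
rewrite [reach _ _ _ _]/= => /orP[/eqP ->|/existsP[z /andP[xz /IH[F [FG Fn Fr]]]]].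
  by exists finset.set0; rewrite finset.sub0set cards0 reach0.
exists ([set x; z]%SET |: F); split.
- by rewrite finset.subUset FG finset.sub1set edgesE xz.
- by rewrite cardsU1 -add1n; apply: leq_add => //; case: (_ \in _).
- have r1 : reach (spanned ([set x; z]%SET |: F)) 1 x z.
    by apply: reach1; rewrite /spanned finset.setU11.
  by apply: (reach_add r1); apply: (reachFF _ Fr); exact: finset.subsetUr.
Qed.

End Spanned.
(** * Sampling *)

Section Sampling.
Local Open Scope ring_scope.
Variables (R : realFieldType) (T : finType) (p : R).
Hypotheses (p0 : 0 < p) (p1 : p < 1).

(* Each element is sampled independently with probability [p]. *)
Let wt (W : {set T}) : R := \prod_i (if i \in W then p else 1 - p).

Let q0 : 0 <= 1 - p. Proof. by rewrite subr_ge0 ltW. Qed.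

Let wt_ge0 W : 0 <= wt W.
Proof. by apply: prodr_ge0 => i _; case: ifP => _ //; rewrite ltW. Qed.

(** In the expanded product of the sums [(0 or p) + (1 - p)], the term of [W] vanishes as soon as
    [W] meets [A]. *)
Let wt_avoid (A : {set T}) : \sum_W wt W * [disjoint W & A]%:R = (1 - p) ^+ #|A|.
Proof.
transitivity (\prod_(i : T) ((if i \in A then 0 else p) + (1 - p))); last first.
  rewrite (bigID (mem A)) /= [X in _ * X]big1 ?mulr1.
    rewrite (eq_bigr (fun=> 1 - p)); first by rewrite prodr_const.
    by move=> i /= ->; rewrite add0r.
  by move=> i /negbTE /= ->; rewrite subrKC.
rewrite bigA_distr; apply: eq_bigr => W _.
case: (boolP [disjoint W & A]) => [dWA|]; rewrite ?mulr1 ?mulr0.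
  apply: eq_bigr => i _; case: ifP => // iW; case: ifP => // iA.
  by have /pred0P/(_ i) := dWA; rewrite /= iW iA.
rewrite /disjoint => /pred0Pn[i /andP[/= iW iA]].
by rewrite (bigD1 i) //= iW iA mul0r.
Qed.

(** Linearity of expectation over the indicators of [i \in W], each of mean [p]. *)
Let wt_card (U : {set T}) : \sum_W wt W * #|W :&: U|%:R = p * #|U|%:R.
Proof.
have H i : \sum_W wt W * (i \in W)%:R = p.
  transitivity (\prod_(j : T) (p + (if j == i then 0 else 1 - p))); last first.
    rewrite (bigD1 i) //= eqxx addr0 big1 ?mulr1 // => j /negbTE ->.
    by rewrite subrKC.
  rewrite bigA_distr; apply: eq_bigr => W _.
  case: (boolP (i \in W)) => iW; rewrite ?mulr1 ?mulr0.
    apply: eq_bigr => j _; case: ifP => // jW; case: eqP => // ji.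
    by rewrite ji iW in jW.
  by rewrite (bigD1 i) //= (negbTE iW) eqxx mul0r.
rewrite mulr_natr -sumr_const -(eq_bigr _ (fun i _ => H i)) exchange_big /=.
apply: eq_bigr => W _; rewrite -mulr_sumr -natr_sum; congr (_ * _%:R).
rewrite -sum1_card big_mkcond [RHS]big_mkcond; apply: eq_bigr => i _ /=.
by rewrite inE andbC; case: (i \in U); case: (i \in W).
Qed.

Let wt1 : \sum_W wt W = 1.
Proof.
have := wt_avoid finset.set0; rewrite cards0 expr0 => <-.
apply: eq_bigr => W _; rewrite (_ : [disjoint W & _] = true) ?mulr1 //.
by apply/pred0P => x /=; rewrite inE andbF.
Qed.

Let sampling_mean (f : {set T} -> R) : exists W, f W <= \sum_X wt X * f X.
Proof.
apply: contrapT => /forallNP H; set m := \sum_X _ in H.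
suff : m < m by rewrite ltxx.
rewrite -[X in X < _]mul1r -wt1 mulr_suml.
have [W0 W0p] : exists W0, 0 < wt W0.
  exists finset.setT; rewrite /wt; apply: prodr_gt0 => i _.
  by rewrite inE.
have lt W : m < f W by rewrite ltNge; apply/negP/H.
rewrite {2}/m (bigD1 W0) //= [X in _ < X](bigD1 W0) //=.
apply: ltr_leD; first by rewrite ltr_pM2l.
by apply: ler_sum => W _; rewrite ler_wpM2l // ltW.
Qed.

(** Remove an element with the largest [f]: its rank is [#|U|], and it contributes one more term of
    a geometric series. Ties only raise ranks, which lowers the sum. *)
Let geometric_rank (f : T -> nat) (U : {set T}) :
  p * \sum_(x in U) (1 - p) ^+ #|[set a in U | (f a <= f x)%N]%SET|
    <= 1 - (1 - p) ^+ #|U|.+1.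
Proof.
have [n] := ubnP #|U|; elim: n U => // n IH U; rewrite ltnS => Un.
have [->|[a aU]] := set_0Vmem U.
  by rewrite big_set0 mulr0 cards0 expr1 subKr ltW.
case: (@arg_maxnP _ a (mem U) f aU) => /= x xU xmax.
have cU : #|U| = #|U :\ x|.+1 by rewrite (cardsD1 x) xU.
have /IH IHx : (#|U :\ x| < n)%N by rewrite -ltnS -cU ltnS.
rewrite (big_setD1 x xU) /= (_ : [set _ in U | _]%SET = U); last first.
  by apply/setP => b; rewrite inE; case: (boolP (b \in U)) => //= /xmax.
set S := \sum_(y in U :\ x) _.
have SIH : p * S <= 1 - (1 - p) ^+ #|U :\ x|.+1.
  apply: le_trans IHx; rewrite ler_pM2l //; apply: ler_sum => y yU.
  rewrite ler_wiXn2l //; first by rewrite gerBl ltW.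
  apply: subset_leq_card; apply/fintype.subsetP => b; rewrite !inE.
  by case/andP => /andP[_ ->] ->.
by move: SIH; rewrite -cU (exprS _ #|U|) mulrDr mulrBl mul1r; lra.
Qed.

(** A pair [(c, c')] counts when [W] misses all points of [U] at most as far from [c] as [c']; by
    [geometric_rank] the expected number of pairs is at most [#|U| / p]. Weighting it by [p ^+ 2]
    balances it against the mean size of [W :&: U], so one sample not above the mean of the sum
    satisfies both bounds. *)
Lemma sampling_lt1 (U : {set T}) (d : T -> T -> nat) :
  exists W : {set T}, [/\ W \subset U, #|W|%:R <= 2 * p * #|U|%:R :> R &
    (\sum_(c in U) #|[set c' in U | [forall w in W, d c c' < d c w]]%SET|)%:R
      <= 2 * #|U|%:R / p :> R].
Proof.
pose S (W : {set T}) := \sum_(c in U) \sum_(c' in U)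
  [disjoint W & [set a in U | (d c a <= d c c')%N]%SET]%:R : R.
have ES : p * \sum_X wt X * S X <= #|U|%:R.
  rewrite (_ : \sum_X _ = \sum_(c in U) \sum_(c' in U)
      (1 - p) ^+ #|[set a in U | (d c a <= d c c')%N]%SET|); last first.
    under eq_bigr do rewrite mulr_sumr; rewrite exchange_big /=.
    apply: eq_bigr => c cU; under eq_bigr do rewrite mulr_sumr.
    by rewrite exchange_big /=; apply: eq_bigr => c' c'U; exact: wt_avoid.
  rewrite mulr_sumr -[#|U|%:R]sumr_const; apply: ler_sum => c cU.
  by rewrite (le_trans (geometric_rank _ _)) // gerBl exprn_ge0.
have [W] := sampling_mean (fun W => #|W :&: U|%:R + p ^+ 2 * S W).
under eq_bigr do rewrite mulrDr mulrCA.
rewrite big_split /= wt_card -mulr_sumr expr2 -mulrA => HW.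
have {}HW : #|W :&: U|%:R + p ^+ 2 * S W <= 2 * p * #|U|%:R.
  by move: ES HW; rewrite -(ler_pM2l p0) expr2; lra.
have S0 : 0 <= S W by do 2 (apply: sumr_ge0 => ? _).
have E : S W = (\sum_(c in U)
    #|[set c' in U | [forall w in W :&: U, (d c c' < d c w)%N]]%SET|)%:R.
  rewrite /S natr_sum; apply: eq_bigr => c cU; rewrite -natr_sum; congr (_%:R).
  rewrite -sum1_card [LHS]big_mkcond [RHS]big_mkcond; apply: eq_bigr => c' _.
  rewrite inE; case: (c' \in U) => //=.
  suff -> : [disjoint W & [set a in U | (d c a <= d c c')%N]%SET] =
      [forall w in W :&: U, (d c c' < d c w)%N] by case: FiniteQuant.quant0b.
  apply/pred0P/forall_inP => [H w|H w /=].
    rewrite inE => /andP[wW wU]; have := H w; rewrite /= inE wW wU /=.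
    by rewrite ltnNge => ->.
  rewrite inE; apply/negP => /andP[wW /andP[wU]]; rewrite leqNgt.
  by rewrite H // inE wW.
exists (W :&: U); split; first exact: finset.subsetIr.
  by apply: le_trans HW; rewrite lerDl mulr_ge0 // sqr_ge0.
rewrite -E ler_pdivlMr // -(ler_pM2l p0).
have : p ^+ 2 * S W <= 2 * p * #|U|%:R by apply: le_trans HW; rewrite lerDr.
by rewrite expr2; lra.
Qed.

End Sampling.

(** For [p >= 1] the choice [W = U] leaves no pair, since [c'] is not strictly closer than
    itself. *)
Lemma sampling (R : realFieldType) (T : finType) (U : {set T})
    (d : T -> T -> nat) (p : R) : (0 < p)%R ->
  exists W : {set T}, [/\ W \subset U, (#|W|%:R <= 2 * p * #|U|%:R :> R)%R &
    ((\sum_(c in U) #|[set c' in U | [forall w in W, d c c' < d c w]]%SET|)%:R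
      <= 2 * #|U|%:R / p :> R)%R].
Proof.
move=> p0; case: (ltP p 1%R) => p1; first exact: sampling_lt1.
exists U; split=> //.
  by rewrite ler_peMl ?ler0n //; move: p1; lra.
rewrite big1 ?divr_ge0 ?mulr_ge0 ?ler0n ?(ltW p0) // => c cU.
apply: eq_card0 => c'; rewrite !inE; apply/negP => /andP[c'U /forall_inP/(_ _ c'U)].
by rewrite ltnn.
Qed.
(** * Levels and path buying *)

Definition near (V : finType) (e : rel V) (W : {set V}) (n : nat) (x : V) : bool :=
  [exists w in W, reach e n x w].

Section Near.
Variables (V : finType) (W : {set V}).
Implicit Types (e : rel V) (x y : V).

Lemma nearP e n x : reflect (exists2 w, w \in W & reach e n x w) (near e W n x).
Proof. exact: exists_inP. Qed.

Lemma near_leq e m n x : (m <= n)%N -> near e W m x -> near e W n x.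
Proof. by move=> mn /nearP[w wW r]; apply/nearP; exists w => //; apply: reach_leq r. Qed.

Lemma near_sub e e' n x : subrel e e' -> near e W n x -> near e' W n x.
Proof. by move=> ee /nearP[w wW r]; apply/nearP; exists w => //; apply: reach_sub r. Qed.

Lemma reach_near e m n x y : reach e m x y -> near e W n y -> near e W (m + n) x.
Proof.
by move=> xy /nearP[w wW r]; apply/nearP; exists w => //; apply: reach_add r.
Qed.

End Near.

(** * Forests, exact paths and the edges bought for one level *)

Section Spanners.
Variables (V : finType) (G : sgraph V).
Implicit Types (F : {set {set V}}) (x y z : V).

(** Each vertex outside [W] that reaches [W] buys one edge, to a neighbour one step closer;
    following these edges is a shortest way to [W]. *)
Lemma forest (W : {set V}) : exists F, [/\ F \subset edges G, (#|F| <= #|V|)%N &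
  forall n x, near G W n x -> near (spanned F) W n x].
Proof.
have /choice[par parP] x : exists y, forall n, near G W n.+1 x -> ~~ near G W n x ->
    G x y && near G W n y.
  case: (EM (exists n, near G W n.+1 x && ~~ near G W n x)) => [[n /andP[n1 n2]]|no].
    case/nearP: (n1) => w wW /=; case/orP => [/eqP xw|/existsP[y /andP[xy yw]]].
      by case/nearP: n2; exists w => //; rewrite xw reach0.
    exists y => n' n1' n2'.
    (* [near] is monotone in its radius, so it changes at one index only and a single parent serves
       every [n]. *)
    have -> : n' = n.
      apply/eqP; rewrite eqn_leq; apply/andP; split; rewrite leqNgt; apply/negP => lt.
        by move: n2'; rewrite (near_leq lt).
      by move: n2; rewrite (near_leq lt).
    by rewrite xy; apply/nearP; exists w.
  by exists x => n n1 n2; case: no; exists n; rewrite n1.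
pose F := [set [set x; par x]%SET | x in V & G x (par x)]%SET.
exists F; split.
- apply/fintype.subsetP => e /imsetP[x]; rewrite inE /= => xp ->.
  by rewrite edgesE.
- by apply: leq_trans (leq_imset_card _ _) _; exact: max_card.
- elim=> [|n IH] x; first by [].
  case: (boolP (near G W n x)) => [/IH H _|n2 n1]; first exact: near_leq H.
  have /andP[xy /IH yn] := parP x n n1 n2; rewrite -add1n; apply: reach_near yn.
  by apply: reach1; apply/imsetP; exists x; rewrite // inE.
Qed.

Lemma exact_path D x y : exists F, [/\ F \subset edges G, (#|F| <= D)%N &
  forall n, (n <= D)%N -> reach G n x y -> reach (spanned F) n x y].
Proof.
case: (leqP (tdist G D x y) D) => h; last first.
  exists finset.set0; rewrite finset.sub0set cards0; split=> // n nD.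
  by rewrite -(tdist_le _ _ _ nD) leqNgt (leq_ltn_trans nD h).
have /short_path_edges[F [FG Fn Fr]] : reach G (tdist G D x y) x y.
  by rewrite -(tdist_le _ _ _ h).
exists F; split=> // [|n nD]; first exact: leq_trans h.
by rewrite -(tdist_le _ _ _ nD) => dn; apply: reach_leq Fr.
Qed.

Lemma exact_paths (P : {set V * V}) D : exists F,
  [/\ F \subset edges G, (#|F| <= #|P| * D)%N &
  forall n x y, (x, y) \in P -> (n <= D)%N -> reach G n x y -> reach (spanned F) n x y].
Proof.
have /choice[f fP] (x : V * V) := exact_path D x.1 x.2.
exists (\bigcup_(x in P) f x)%SET; split.
- by apply/bigcupsP => x _; case: (fP x).
- rewrite -sum_nat_const.
  apply: (@leq_trans (\sum_(x in P) #|f x|)); last by apply: leq_sum => x _; case: (fP x).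
  elim/big_rec2: _ => [|x A n _ IH]; first by rewrite cards0.
  by rewrite (leq_trans (leq_card_setU _ _)) // leq_add2l.
- move=> n x y xyP nD r; have [_ _ /(_ n nD r)] := fP (x, y).
  by apply: reachFF; apply: (finset.bigcup_sup (x, y)).
Qed.

Lemma card_dep (T : finType) (U : {set T}) (b : T -> T -> bool) :
  #|[set x : T * T | [&& x.1 \in U, x.2 \in U & b x.1 x.2]]%SET| =
  \sum_(c in U) #|[set c' in U | b c c']%SET|.
Proof.
rewrite -sum1_card; under [RHS]eq_bigr do rewrite -sum1_card.
by rewrite pair_big_dep /=; apply: eq_bigl => x; rewrite !inE.
Qed.

(** Buy shortest paths to the centres strictly closer than [W], and one to the nearest point of [W].
    If neither [(x, y)] nor [(y, x)] is bought, both centres have [W] within their mutual distance.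
    For [p < 1] the extra path per centre fits into [#|U| / p], making the factor 3. *)
Lemma level_spanner (R : realFieldType) (U : {set V}) (D : nat) (p : R) : (0 < p)%R ->
  exists (W : {set V}) F, [/\ W \subset U, (#|W|%:R <= 2 * p * #|U|%:R :> R)%R,
    F \subset edges G, (#|F|%:R <= 3 * #|U|%:R * D%:R / p :> R)%R &
    forall n x y, x \in U -> y \in U -> (n <= D)%N -> reach G n x y ->
      reach (spanned F) n x y \/ near (spanned F) W n x /\ near (spanned F) W n y].
Proof.
move=> p0; case: (ltP p 1%R) => p1; last first.
  exists U, finset.set0; split=> //.
  - by rewrite ler_peMl ?ler0n //; move: p1; lra.
  - exact: finset.sub0set.
  - by rewrite cards0 divr_ge0 ?mulr_ge0 ?ler0n // ltW.
  - by move=> n x y xU yU _ _; right; split; apply/nearP;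
      [exists x|exists y]; rewrite // reach0.
have [W [WU Wc WS]] := sampling U (tdist G D) p0.
(* [g x] is a point of [W] nearest to [x]. The default [x] for empty [W] is harmless, as nothing is
   near [W] then. *)
have /choice[g gP] x : exists w, forall n, (n <= D)%N -> near G W n x ->
    w \in W /\ reach G n x w.
  case: (set_0Vmem W) => [W0|[w wW]].
    by exists x => n _ /nearP[w]; rewrite W0 inE.
  case: (@arg_minnP _ w (mem W) (tdist G D x) wW) => /= a aW amin.
  exists a => n nD /nearP[w' w'W r]; split=> //.
  by rewrite -(tdist_le _ _ _ nD) (leq_trans (amin _ w'W)) // tdist_le.
pose b c c' := [forall w in W, (tdist G D c c' < tdist G D c w)%N].
pose P1 := [set x : V * V | [&& x.1 \in U, x.2 \in U & b x.1 x.2]]%SET.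
pose P := (P1 :|: [set (c, g c) | c in U])%SET.
have [F [FG Fc Fr]] := exact_paths P D.
exists W, F; split=> //.
- have h1 : (#|P1|%:R <= 2 * #|U|%:R / p :> R)%R by rewrite card_dep.
  have h2 : (#|P| <= #|P1| + #|U|)%N.
    by rewrite (leq_trans (leq_card_setU _ _)) // leq_add2l leq_imset_card.
  apply: (@le_trans _ _ ((#|P1| + #|U|) * D)%:R%R).
    by rewrite ler_nat (leq_trans Fc) // leq_mul2r h2 orbT.
  rewrite natrM natrD mulrAC ler_wpM2r ?ler0n //.
  have : (#|U|%:R <= #|U|%:R / p :> R)%R.
    by rewrite ler_pdivlMr // ler_piMr ?ler0n // ltW.
  by move: h1; lra.
- move=> n x y xU yU nD r.
  have key u v : u \in U -> v \in U -> reach G n u v -> ~~ b u v -> near (spanned F) W n u.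
    move=> uU vU uv; rewrite negb_forall => /existsP[w].
    rewrite negb_imply -leqNgt => /andP[wW le].
    have nu : near G W n u.
      apply/nearP; exists w => //.
      by rewrite -(tdist_le _ _ _ nD) (leq_trans le) // tdist_le.
    have [gW gr] := gP u n nD nu.
    apply/nearP; exists (g u) => //; apply: Fr => //.
    by rewrite inE; apply/orP; right; apply/imsetP; exists u.
  have use u v : u \in U -> v \in U -> reach G n u v -> b u v -> reach (spanned F) n u v.
    by move=> uU vU uv buv; apply: Fr => //; rewrite !inE /= uU vU buv.
  have r' : reach G n y x by rewrite reachG_sym.
  case: (boolP (b x y)) => [/use|bxy]; first by left; auto.
  case: (boolP (b y x)) => [/use|byx]; first by left; rewrite reachF_sym; auto.
  by right; split; [apply: (key x y)|apply: (key y x)].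
Qed.

(** * Geodesics and path buying *)

Lemma walk (e : rel V) n (f : nat -> V) :
    (forall i, (i < n)%N -> e (f i) (f i.+1)) ->
  forall i j, (i <= j)%N -> (j <= n)%N -> reach e (j - i) (f i) (f j).
Proof.
move=> fe i; elim=> [|j IH] ij jn.
  by move: ij; rewrite leqn0 => /eqP ->; exact: reach0.
move: ij; rewrite leq_eqVlt => /orP[/eqP ->|ij]; first exact: reach0.
rewrite subSn // -addn1; apply: (reach_add (IH ij (ltnW jn))).
exact/reach1/fe.
Qed.

(** A shortcut between two vertices of a shortest path would shorten the whole path. *)
Lemma geodesic n x y : reach G n x y -> exists (m : nat) (f : nat -> V),
  [/\ (m <= n)%N, f 0 = x, f m = y, (forall i, (i < m)%N -> G (f i) (f i.+1)) &
   forall l i j, (i <= j)%N -> (j <= m)%N -> reach G l (f i) (f j) -> (j - i <= l)%N].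
Proof.
move=> r; have ex : exists n, reach G n x y by exists n.
case: (ex_minnP ex) => m rm mmin.
have /reachP[p [pp pl ps]] := rm.
have sp : size p = m.
  apply/eqP; rewrite eqn_leq ps /=; apply: mmin.
  by apply/reachP; exists p.
pose f i := nth x (x :: p) i.
have fe i : (i < m)%N -> G (f i) (f i.+1).
  by rewrite -sp => im; move/pathP: pp => /(_ x i im).
have f0 : f 0 = x by [].
have fm : f m = y by rewrite /f -sp -pl -last_nth.
exists m, f; split=> //; first exact: mmin.
move=> l i j ij jm lr.
have := reach_add (walk fe (leq0n i) (leq_trans ij jm)) (reach_add lr (walk fe jm (leqnn m))).
by rewrite f0 fm => /mmin; lia.
Qed.

(* The vertices of a geodesic that share a centre are within distance 2 of each
   other, hence told apart by their indices modulo 3. *)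
Lemma card_centers n (f : nat -> V) (I : {set 'I_n}) (cc : 'I_n -> V) :
    (forall l i j, (i <= j)%N -> (j <= n)%N -> reach G l (f i) (f j) -> (j - i <= l)%N) ->
    (forall i, i \in I -> reach G 1 (f i) (cc i)) ->
  (#|I| <= 3 * #|cc @: I|)%N.
Proof.
move=> fmin ccr.
pose g (i : 'I_n) : V * 'I_3 := (cc i, inord (i %% 3)).
have ginj : {in I &, injective g}.
  have H (i j : 'I_n) : i \in I -> j \in I -> (i <= j)%N -> g i = g j -> i = j.
    move=> iI jI ij [cij /(congr1 val)]; rewrite /= !inordK ?ltn_mod // => m3.
    have r : reach G 2 (f i) (f j).
      by apply: (reach_add (ccr i iI)); rewrite cij reachG_sym ccr.
    have le := fmin _ _ _ ij (ltnW (ltn_ord j)) r.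
    by apply: val_inj => /=; clear -m3 le ij; lia.
  move=> i j iI jI gij; case: (leqP i j) => [ij|/ltnW ji]; first exact: H.
  by apply/esym/H.
rewrite -(card_in_imset ginj) mulnC -[X in (_ * X)%N](card_ord 3) -cardsT -cardsX.
apply: subset_leq_card; apply/fintype.subsetP => _ /imsetP[i iI ->].
by rewrite !inE /= andbT; apply: imset_f.
Qed.

Section PathBuying.
Variables (D : nat) (F F' : {set {set V}}).
Hypothesis FF' : F \subset F'.

(** The cap keeps every pair within 5 of the least possible value, so each pair pays for a bounded
    number of edges. A connection with error at most 4 lies strictly below the cap and counts as
    progress. *)
Definition capped_dist F1 (u : V * V) :=
  minn (tdist (spanned F1) D u.1 u.2) (tdist G D u.1 u.2 + 5).

Lemma capped_dist_le u : (capped_dist F' u <= capped_dist F u)%N.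
Proof.
by rewrite leq_min geq_minr andbT geq_min tdist_sub //; exact: spanned_subset.
Qed.

Lemma capped_dist_lt l a b : (l <= D)%N -> reach (spanned F') l a b ->
    ~~ reach (spanned F) l a b -> (forall l', reach G l' a b -> (l <= l' + 4)%N) ->
  (capped_dist F' (a, b) < capped_dist F (a, b))%N.
Proof.
move=> lD r' r lo; rewrite /capped_dist /=.
have h1 : (tdist (spanned F') D a b <= l)%N by rewrite tdist_le.
have h2 : (l < tdist (spanned F) D a b)%N by rewrite ltnNge tdist_le.
have h3 : (l <= tdist G D a b + 4)%N.
  case: (leqP (tdist G D a b) D) => h; first by apply: lo; rewrite -(tdist_le _ _ _ h).
  by apply: leq_trans lD _; rewrite (leq_trans (ltnW h)) ?leq_addr.
by clear -h1 h2 h3; lia.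
Qed.

(** Distinct centres give distinct pairs, and each of these pairs drops by at least 1. *)
Lemma capped_dist_sum (P : {set V * V}) (C : {set V}) :
    (forall c, c \in C -> exists2 a, (a, c) \in P &
       (capped_dist F' (a, c) < capped_dist F (a, c))%N) ->
  (\sum_(u in P) capped_dist F' u + #|C| <= \sum_(u in P) capped_dist F u)%N.
Proof.
move=> H; pose Q := [set u in P | (capped_dist F' u < capped_dist F u)%N]%SET.
have CQ : (#|C| <= #|Q|)%N.
  apply: (@leq_trans #|[set u.2 | u in Q]%SET|); last exact: leq_imset_card.
  apply: subset_leq_card; apply/fintype.subsetP => c /H[a aP lt].
  by apply/imsetP; exists (a, c); rewrite // inE aP.
apply: (@leq_trans (\sum_(u in P) (capped_dist F' u + (u \in Q)))); last first.
  apply: leq_sum => u uP; rewrite inE uP /=; case: ltnP => h; rewrite ?addn1 //.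
  by rewrite addn0 capped_dist_le.
rewrite big_split /= leq_add2l (leq_trans CQ) // -sum1_card big_mkcond [leqRHS]big_mkcond.
apply: leq_sum => u _ /=; case: (boolP (u \in Q)) => //.
by rewrite inE => /andP[-> _].
Qed.

End PathBuying.

(* Otherwise, buying a geodesic from [z] to [z'] would lower the potential: every
   centre along it would get closer to the centre of [z] or to that of [z']. *)
Lemma buy_path (F0 : {set {set V}}) (V1 W : {set V}) (P : {set V * V}) (m D : nat)
    (F : {set {set V}}) :
    (forall x y, G x y -> ~~ spanned F0 x y -> near (spanned F0) V1 1 x) ->
    (m + 2 <= D)%N -> F0 \subset F -> F \subset edges G ->
    (forall n x, near G W n x -> near (spanned F) W n x) ->
    (forall a b, a \in V1 -> b \in V1 -> (a, b) \notin P ->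
       exists2 w, w \in W & (tdist G D a w <= tdist G D a b)%N) ->
    (forall F', F \subset F' -> F' \subset edges G ->
      (#|F| + 4 * \sum_(u in P) capped_dist D F u
         <= #|F'| + 4 * \sum_(u in P) capped_dist D F' u)%N) ->
  forall n z z', (n <= m)%N -> near (spanned F0) V1 1 z -> near (spanned F0) V1 1 z' ->
    reach G n z z' -> reach (spanned F) (n + 6) z z' \/
    near (spanned F) W (2 * m + 3) z /\ near (spanned F) W (2 * m + 3) z'.
Proof.
move=> cl mD F0F FG fW notP Fmin n z z' nm /nearP[c cV1 zc] /nearP[c' cV1' zc'] r.
case: (boolP (near (spanned F) W (2 * m + 3) z && near (spanned F) W (2 * m + 3) z'))
  => [/andP|far]; [by right|left].
have {r}[n0 [f [n0n f0 fn fe fmin]]] := geodesic r.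
apply: contrapT => /negP nr.
have {nr} nr : ~~ reach (spanned F) (n0 + 6) z z'.
  by apply: contra nr; apply: reach_leq; rewrite leq_add2r.
pose I := [set i : 'I_n0 | ~~ spanned F (f i) (f i.+1)]%SET.
have /choice[cc ccP] (i : 'I_n0) : exists b,
    i \in I -> b \in V1 /\ reach (spanned F0) 1 (f i) b.
  case: (boolP (i \in I)) => [|_]; last by exists c.
  rewrite inE => iF; have /nearP[b bV br] : near (spanned F0) V1 1 (f i).
    apply: (cl _ (f i.+1)); first exact/fe/ltn_ord.
    by apply: contra iF; exact: spanned_subset.
  by exists b.
pose F' := (F :|: [set [set f i; f i.+1]%SET | i : 'I_n0 in I])%SET.
have FF' : F \subset F' by exact: finset.subsetUl.
have F'G : F' \subset edges G.
  rewrite finset.subUset FG; apply/fintype.subsetP => e /imsetP[i _ ->].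
  by rewrite edgesE fe.
have F'e i : (i < n0)%N -> spanned F' (f i) (f i.+1).
  move=> i0; case: (boolP (spanned F (f i) (f i.+1))) => [|h].
    exact: spanned_subset.
  rewrite /spanned inE; apply/orP; right; apply/imsetP.
  by exists (Ordinal i0); rewrite // inE.
have up x y k : reach (spanned F0) k x y -> reach (spanned F) k x y by exact: reachFF.
have up' x y k : reach (spanned F0) k x y -> reach (spanned F') k x y.
  by move=> /up; exact: reachFF.
have upG x y k : reach (spanned F0) k x y -> reach G k x y by move=> /up; exact: reachFG.
have c0 : reach (spanned F0) 1 c (f 0) by rewrite f0 reachF_sym.
have c0' : reach (spanned F0) 1 (f n0) c' by rewrite fn.
have rzz' : reach G n0 z z'.
  by have := walk fe (leq0n n0) (leqnn n0); rewrite subn0 f0 fn.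
(* A pair outside [P] puts [W] within [l] of [a], hence close to both ends of the path, which [far]
   excludes. *)
have toP a b l : a \in V1 -> b \in V1 -> (l <= n0 + 2)%N ->
    (near G W l a -> near G W (2 * m + 3) z /\ near G W (2 * m + 3) z') ->
    reach G l a b -> (a, b) \in P.
  move=> aV bV ln h lr; apply: contraT => /(notP _ _ aV bV)[w wW le].
  have lD : (l <= D)%N by rewrite (leq_trans ln) // (leq_trans _ mD) // leq_add2r (leq_trans n0n).
  have [|nz nz'] := h; last by case/negP: far; rewrite !fW.
  by apply/nearP; exists w => //; rewrite -(tdist_le _ _ _ lD) (leq_trans le) // tdist_le.
have key a b l : a \in V1 -> b \in V1 -> (l <= n0 + 2)%N ->
    (near G W l a -> near G W (2 * m + 3) z /\ near G W (2 * m + 3) z') ->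
    reach (spanned F') l a b -> ~~ reach (spanned F) l a b ->
    (forall l', reach G l' a b -> (l <= l' + 4)%N) ->
    exists2 a, (a, b) \in P & (capped_dist D F' (a, b) < capped_dist D F (a, b))%N.
  move=> aV bV ln h lr' lr lo; exists a.
    by apply: (toP a b l) => //; exact: reachFG lr'.
  apply: capped_dist_lt lr' lr lo => //.
  by rewrite (leq_trans ln) // (leq_trans _ mD) // leq_add2r (leq_trans n0n).
have gain : forall b, b \in cc @: I ->
    exists2 a, (a, b) \in P & (capped_dist D F' (a, b) < capped_dist D F (a, b))%N.
  move=> b /imsetP[i iI ->]; have [bV br] := ccP i iI.
  have i0 := ltn_ord i.
  have b1 : reach (spanned F0) 1 (cc i) (f i) by rewrite reachF_sym.
  have r1 : reach (spanned F') (i + 2) c (cc i).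
    rewrite (_ : i + 2 = 1 + i + 1)%N; last by clear; lia.
    apply: reach_add (up' _ _ _ br); apply: (reach_add (up' _ _ _ c0)).
    by have := walk F'e (leq0n i) (ltnW i0); rewrite subn0.
  have r2 : reach (spanned F') (n0 - i + 2) c' (cc i).
    rewrite reachF_sym (_ : n0 - i + 2 = 1 + (n0 - i) + 1)%N; last by clear; lia.
    apply: reach_add (up' _ _ _ c0'); apply: (reach_add (up' _ _ _ b1)).
    exact: (walk F'e (ltnW i0) (leqnn n0)).
  (* If [c] and [c'] were both already this close to [cc i], going through it would join [z] to [z']
     with error 6. So one of the two distances drops. *)
  case: (boolP (reach (spanned F) (i + 2) c (cc i))) => r1F.
    case: (boolP (reach (spanned F) (n0 - i + 2) c' (cc i))) => r2F.
      case/negP: nr; have -> : (n0 + 6 = 1 + ((i + 2) + (n0 - i + 2 + 1)))%N.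
        by clear -i0; lia.
      apply: (reach_add (up _ _ _ zc)); apply: (reach_add r1F).
      by rewrite reachF_sym in r2F; apply: (reach_add r2F); rewrite reachF_sym up.
    apply: (key c' (cc i) (n0 - i + 2)%N) => //.
    - by rewrite leq_add2r leq_subr.
    (* [W] is within [n0 + 3] of one end, and [n0] more steps reach it from the other: hence the
       radius [2 * m + 3]. *)
    - move=> nc'; have nz' : near G W (1 + (n0 - i + 2)) z' := reach_near (upG _ _ _ zc') nc'.
      split; last by apply: near_leq nz'; clear -i0 n0n nm; lia.
      by apply: near_leq (reach_near rzz' nz'); clear -i0 n0n nm; lia.
    (* Both centres are within 1 of the geodesic, so their distance in [G] is at least [n0 - i - 2],
       at most 4 below the length bought. *)
    - move=> l' lr; have r' : reach G (1 + l' + 1) (f n0) (f i).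
        by apply: reach_add (upG _ _ _ b1); apply: reach_add lr; exact: upG.
      have := fmin (1 + l' + 1)%N i n0 (ltnW i0) (leqnn n0).
      by rewrite reachG_sym => /(_ r'); clear; lia.
  apply: (key c (cc i) (i + 2)%N) => //.
  - by rewrite leq_add2r ltnW.
  - move=> nc; have nz : near G W (1 + (i + 2)) z := reach_near (upG _ _ _ zc) nc.
    split; first by apply: near_leq nz; clear -i0 n0n nm; lia.
    rewrite reachG_sym in rzz'.
    by apply: near_leq (reach_near rzz' nz); clear -i0 n0n nm; lia.
  - move=> l' lr; have r' : reach G (1 + l' + 1) (f 0) (f i).
      apply: reach_add (upG _ _ _ b1); apply: reach_add lr.
      by rewrite reachG_sym; exact: upG.
    by have := fmin _ _ _ (leq0n i) (ltnW i0) r'; clear; lia.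
have {gain} gain := capped_dist_sum FF' gain.
have cI : (#|I| <= 3 * #|cc @: I|)%N.
  by apply: card_centers fmin _ => i /ccP[_]; exact: upG.
have cF' : (#|F'| <= #|F| + #|I|)%N.
  by rewrite (leq_trans (leq_card_setU _ _)) // leq_add2l leq_imset_card.
(* Buying costs at most 3 edges per centre on the path, while the potential falls by 4 per centre;
   minimality leaves no missing edge. *)
have I0 : #|I| = 0.
  by move: (Fmin _ FF' F'G) gain cI cF'; clear; lia.
case/negP: nr; apply: (@reach_leq _ _ n0); first exact: leq_addr.
rewrite -f0 -fn -[n0 in reach _ n0]subn0; apply: (@walk _ n0) => // i i0.
apply: contraT => h; have : Ordinal i0 \in I by rewrite inE h.
by rewrite (cards0_eq I0) inE.
Qed.

(** Minimise the potential over the edge sets that contain [F0] and a forest towards [W]. Compared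
    with this starting set, each pair saves at most 5, with weight 4, and there are at most
    [2 * #|V1| / p] pairs: hence 40. *)
Lemma path_buying (R : realFieldType) F0 (V1 : {set V}) (p : R) (m : nat) :
    (0 < p)%R -> F0 \subset edges G ->
    (forall x y, G x y -> ~~ spanned F0 x y -> near (spanned F0) V1 1 x) ->
  exists (W : {set V}) F, [/\ W \subset V1, (#|W|%:R <= 2 * p * #|V1|%:R :> R)%R,
    F0 \subset F, F \subset edges G &
    (#|F|%:R <= #|F0|%:R + #|V|%:R + 40 * #|V1|%:R / p :> R)%R /\
    forall n z z', (n <= m)%N -> near (spanned F0) V1 1 z -> near (spanned F0) V1 1 z' ->
      reach G n z z' -> reach (spanned F) (n + 6) z z' \/
      near (spanned F) W (2 * m + 3) z /\ near (spanned F) W (2 * m + 3) z'].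
Proof.
(* Centres within 1 of two vertices at distance at most [m] are at most [m + 2] apart. *)
move=> p0 F0G cl; pose D := (m + 2)%N.
have [W [WV Wc WS]] := sampling V1 (tdist G D) p0.
pose b a a' := [forall w in W, (tdist G D a a' < tdist G D a w)%N].
pose P := [set u : V * V | [&& u.1 \in V1, u.2 \in V1 & b u.1 u.2]]%SET.
have [T [TG Tc Tr]] := forest W.
pose F1 := (F0 :|: T)%SET.
pose ok F := (F1 \subset F) && (F \subset edges G).
have ok1 : ok F1 by rewrite /ok fintype.subxx finset.subUset F0G TG.
pose phi F := (#|F| + 4 * \sum_(u in P) capped_dist D F u)%N.
case: (@arg_minnP _ F1 ok phi ok1) => F /andP[F1F FG] Fmin.
have F0F : F0 \subset F by exact: fintype.subset_trans (finset.subsetUl _ _) F1F.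
exists W, F; split=> //; split.
  have h1 : (#|P|%:R <= 2 * #|V1|%:R / p :> R)%R by rewrite card_dep.
  have h2 : (#|F1| <= #|F0| + #|V|)%N.
    by rewrite (leq_trans (leq_card_setU _ _)) // leq_add2l.
  have lo : (\sum_(u in P) tdist G D u.1 u.2 <= \sum_(u in P) capped_dist D F u)%N.
    apply: leq_sum => u _; rewrite leq_min leq_addr andbT tdist_sub //.
    exact: spanned_edges.
  have hi : (\sum_(u in P) capped_dist D F1 u <=
             \sum_(u in P) tdist G D u.1 u.2 + #|P| * 5)%N.
    by rewrite -sum_nat_const -big_split /=; apply: leq_sum => u _; exact: geq_minr.
  have : (#|F| <= #|F0| + #|V| + 20 * #|P|)%N.
    by move: (Fmin _ ok1) h2 lo hi; rewrite /phi; clear; lia.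
  rewrite -(ler_nat R) natrD (natrD _ #|F0|) (natrM _ 20).
  by move: h1; rewrite -!mulrA; lra.
apply: (@buy_path F0 V1 W P m D) => //.
- move=> n x /Tr; apply: near_sub; apply: spanned_subset.
  by apply: fintype.subset_trans F1F; exact: finset.subsetUr.
- move=> a a' aV aV'; rewrite inE /= aV aV' /= negb_forall => /existsP[w].
  by rewrite negb_imply -leqNgt => /andP[wW le]; exists w.
- move=> F' FF' F'G; apply: Fmin; rewrite /ok F'G andbT.
  exact: fintype.subset_trans FF'.
Qed.

End Spanners.

(** * The hierarchy of centres *)

Section Hierarchy.
Variables (V : finType) (G : sgraph V).
Implicit Types (F : {set {set V}}) (x y z : V).

(* A path of length [n] from [u] to [v] that [F] follows with error [E] in total,
   except for a middle part with both ends close to [W]. *)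
Definition detour F (W : {set V}) (r n E : nat) u v := exists z z' n1 n2 n3 e1 e2,
  [/\ (n1 + n2 + n3 <= n)%N /\ (e1 + e2 <= E)%N,
      [/\ reach G n1 u z, reach G n2 z z' & reach G n3 z' v],
      reach (spanned F) (n1 + e1) u z /\ reach (spanned F) (n3 + e2) z' v &
      near (spanned F) W r z /\ near (spanned F) W r z'].

Definition approximates F (W : {set V}) (m r E : nat) := forall n u v, (n <= m)%N ->
  reach G n u v -> reach (spanned F) (n + E) u v \/ detour F W r n E u v.

(** Cut off one segment at a time. Two detours merge into one from the first [z] to the last [z']:
    the middle part absorbs all that lies between, so [r] does not grow. *)
Lemma approximates_concat F W m r E q :
  approximates F W m r E -> approximates F W (q * m) r (q * E).
Proof.
move=> H; elim: q => [|q IH] n u v nm uv.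
  move: nm; rewrite mul0n leqn0 => /eqP n0; move: uv; rewrite n0 => /eqP ->.
  by left; exact: reach0.
have n1m : (minn n m <= m)%N by exact: geq_minr.
have n2m : (n - minn n m <= q * m)%N by move: nm; rewrite mulSn; clear; lia.
have En : (n = minn n m + (n - minn n m))%N by clear; lia.
move: n1m n2m En; set n1 := minn n m; set n2 := (n - n1)%N => n1m n2m En.
have [x ux xv] : exists2 x, reach G n1 u x & reach G n2 x v.
  by apply: reach_split; rewrite -En.
case: (H _ _ _ n1m ux) => [h1|h1]; case: (IH _ _ _ n2m xv) => [h2|h2].
- left; have -> : (n + q.+1 * E = n1 + E + (n2 + q * E))%N by rewrite En mulSn; clear; lia.
  exact: reach_add h1 h2.
- right; case: h2 => z [z' [a [b [c [e [e' [[h3 h3'] [ga gb gc] [fa fc] nz]]]]]]].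
  exists z, z', (n1 + a)%N, b, c, (E + e)%N, e'; split=> //.
  + by rewrite mulSn; clear -En h3 h3'; lia.
  + by split=> //; apply: reach_add ga.
  + split=> //; rewrite (_ : n1 + a + (E + e) = n1 + E + (a + e))%N; last by clear; lia.
    exact: reach_add fa.
- right; case: h1 => z [z' [a [b [c [e [e' [[h3 h3'] [ga gb gc] [fa fc] nz]]]]]]].
  exists z, z', a, b, (c + n2)%N, e, (e' + q * E)%N; split=> //.
  + by rewrite mulSn; clear -En h3 h3'; lia.
  + by split=> //; apply: reach_add xv.
  + split=> //; rewrite (_ : c + n2 + (e' + q * E) = c + e' + (n2 + q * E))%N.
      exact: reach_add h2.
    by clear; lia.
- right; case: h1 => z [z1 [a [b [c [e [e1 [[h3 h3'] [ga gb gc] [fa _] [nz _]]]]]]]].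
  case: h2 => z2 [z' [a' [b' [c' [e2 [e' [[h4 h4'] [ga' gb' gc'] [_ fc] [_ nz']]]]]]]].
  exists z, z', a, (b + c + (a' + b'))%N, c', e, e'; split=> //.
  + by rewrite mulSn; clear -En h3 h3' h4 h4'; lia.
  + by split=> //; apply: reach_add (reach_add ga' gb'); exact: reach_add gc.
Qed.

(** On a geodesic, the first and the last missing edge delimit the middle part. Outside it [F] makes
    no error; its ends are within 1 of [V1], so path buying applies. *)
Lemma first_level (R : realFieldType) (p0 p1 : R) (m : nat) :
    (0 < p0)%R -> (0 < p1)%R ->
  exists (V1 W : {set V}) F, [/\ (#|V1|%:R <= 2 * p0 * #|V|%:R :> R)%R,
    (#|W|%:R <= 2 * p1 * #|V1|%:R :> R)%R, F \subset edges G,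
    (#|F|%:R <= #|V|%:R + 3 * #|V|%:R / p0 + 40 * #|V1|%:R / p1 :> R)%R &
    approximates F W m (2 * m + 3) 6].
Proof.
move=> p0_gt0 p1_gt0.
(* With length bound 1, level 0 keeps every edge except those with both ends within 1 of [V1]. *)
have [V1 [F0 [_ Vc F0G F0c H0]]] := level_spanner G finset.setT 1 p0_gt0.
rewrite cardsT in Vc F0c.
have cl x y : G x y -> ~~ spanned F0 x y -> near (spanned F0) V1 1 x.
  move=> xy nxy.
  case: (H0 1 x y (finset.in_setT _) (finset.in_setT _) (leqnn 1) (reach1 xy)) => [|[] //].
  case/orP => [/eqP E|/existsP[z /andP[xz /eqP E]]].
    by rewrite E adj_irr in xy.
  by rewrite -E xz in nxy.
have [W [F [_ Wc F0F FG [Fc HF]]]] := path_buying m p1_gt0 F0G cl.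
exists V1, W, F; split=> //; first by move: Fc F0c; rewrite mulr1; lra.
move=> n u v nm /geodesic[n' [f [n'n <- <- fe _]]].
pose miss i := (i < n')%N && ~~ spanned F (f i) (f i.+1).
case: (EM (exists i, miss i)) => [ex|no]; last first.
  left; apply: (@reach_leq _ _ n'); first exact: leq_trans n'n (leq_addr _ _).
  rewrite -[n' in reach _ n']subn0; apply: (@walk _ _ n') => // i i0.
  by apply: contraT => h; case: no; exists i; rewrite /miss i0.
have bd i : miss i -> (i <= n')%N by case/andP => /ltnW.
case: (ex_minnP ex) => i /andP[i0 iF] imin.
case: (ex_maxnP ex bd) => j /andP[j0 jF] jmax.
have ij : (i <= j)%N by apply: imin; rewrite /miss j0.
have F0miss x y : ~~ spanned F x y -> ~~ spanned F0 x y.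
  by apply: contra; exact: spanned_subset.
have ni := cl _ _ (fe _ i0) (F0miss _ _ iF).
have nj : near (spanned F0) V1 1 (f j.+1).
  apply: (cl _ (f j)); first by rewrite adj_sym; exact: fe.
  by rewrite spanned_sym; exact: F0miss.
have wi : reach (spanned F) i (f 0) (f i).
  have := @walk _ (spanned F) i f _ 0 i (leq0n i) (leqnn i); rewrite subn0; apply=> l li.
  apply: contraT => h; have /imin : miss l by rewrite /miss (ltn_trans li).
  by rewrite leqNgt li.
have wj : reach (spanned F) (n' - j.+1) (f j.+1) (f n').
  have := @walk _ (spanned F) (n' - j.+1) (fun l => f (j.+1 + l)) _ 0 (n' - j.+1) _ _.
  rewrite subn0 addn0 subnKC //; apply=> // l li.
  apply: contraT => h; have /jmax : miss (j.+1 + l)%N.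
    by rewrite /miss addnS in h *; rewrite h andbT; clear -li; lia.
  by clear; lia.
have wij : reach G (j.+1 - i) (f i) (f j.+1) by apply: walk fe _ _ _ _ => //; exact: ltnW.
have wi' := reachFG FG wi; have wj' := reachFG FG wj.
have le : (j.+1 - i <= m)%N by clear -j0 n'n nm; lia.
case: (HF _ _ _ le ni nj wij) => [h|[h h']]; [left|right].
  apply: (@reach_leq _ _ (i + (j.+1 - i + 6) + (n' - j.+1))).
    by clear -ij j0 n'n; lia.
  by apply: reach_add wj; apply: reach_add h.
exists (f i), (f j.+1), i, (j.+1 - i)%N, (n' - j.+1)%N, 0%N, 0%N; rewrite !addn0.
by split=> //; split=> //; clear -ij j0 n'n; lia.
Qed.

(** The ends of a detour have centres at most [q * m + 2 * r] apart. Joining them exactly adds four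
    trips of length [r]; otherwise the next centres are within the middle length plus [3 * r] of
    both ends. *)
Lemma next_level (R : realFieldType) F (W : {set V}) (m r E q : nat) (p : R) :
    (0 < p)%R -> F \subset edges G -> approximates F W m r E ->
  exists (W' : {set V}) F', [/\ (#|W'|%:R <= 2 * p * #|W|%:R :> R)%R,
    F' \subset edges G,
    (#|F'|%:R <= #|F|%:R + 3 * #|W|%:R * (q * m + 2 * r)%:R / p :> R)%R &
    approximates F' W' (q * m) (q * m + 3 * r) (q * E + 4 * r)].
Proof.
move=> p0 FG HF.
have [W' [F1 [_ Wc F1G F1c H1]]] := level_spanner G W (q * m + 2 * r) p0.
exists W', (F :|: F1)%SET; split=> //; first by rewrite finset.subUset FG.
  have : (#|F :|: F1| <= #|F| + #|F1|)%N by exact: leq_card_setU.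
  by rewrite -(ler_nat R) natrD => /le_trans; apply; rewrite lerD2l.
have up n x y : reach (spanned F) n x y -> reach (spanned (F :|: F1)) n x y.
  by apply: reachFF; exact: finset.subsetUl.
have up1 n x y : reach (spanned F1) n x y -> reach (spanned (F :|: F1)) n x y.
  by apply: reachFF; exact: finset.subsetUr.
have nup n x : near (spanned F1) W' n x -> near (spanned (F :|: F1)) W' n x.
  by apply: near_sub; apply: spanned_subset; exact: finset.subsetUr.
move=> n u v nm uv; case: (approximates_concat HF nm uv) => [h|].
  by left; apply/up; apply: reach_leq h; rewrite addnA leq_addr.
case=> z [z' [a [b [c [e [e' [[h3 h3'] [ga gb gc] [fa fc]]]]]]]].
case=> /nearP[x xW zx] /nearP[x' xW' zx'].
have zxG : reach G r z x := reachFG FG zx.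
have zxG' : reach G r z' x' := reachFG FG zx'.
have xx' : reach G (r + b + r) x x'.
  by apply: reach_add zxG'; apply: reach_add gb; rewrite reachG_sym.
have le : (r + b + r <= q * m + 2 * r)%N by clear -h3 nm; lia.
case: (H1 _ _ _ xW xW' le xx') => [h|[h h']]; [left|right].
  apply: (@reach_leq _ _ (a + e + r + (r + b + r) + r + (c + e'))).
    by clear -h3 h3'; lia.
  apply: reach_add (up _ _ _ fc); apply: (@reach_add _ _ _ _ _ x' z'); last first.
    by rewrite reachF_sym up.
  by apply: reach_add (up1 _ _ _ h); apply: reach_add (up _ _ _ zx); exact: up.
exists z, z', a, b, c, e, e'; split=> //; split=> //.
- by clear -h3'; lia.
- exact: up.
- exact: up.
- by apply: near_leq (reach_near (up _ _ _ zx) (nup _ _ h)); clear -h3 nm; lia.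
- by apply: near_leq (reach_near (up _ _ _ zx') (nup _ _ h')); clear -h3 nm; lia.
Qed.

(* [rad m i] bounds the distance of unresolved vertices to the centres of level
   [i + 1], and [err m i] the additive error at distances up to [m ^ i]. *)
Fixpoint rad (m i : nat) : nat :=
  if i is j.+1 then if j is 0 then 2 * m + 3 else m ^ i + 3 * rad m j else 0.

Fixpoint err (m i : nat) : nat :=
  if i is j.+1 then if j is 0 then 6 else m * err m j + 4 * rad m j else 0.

(* Bound for the number of edges bought at level [i], per centre and with the
   sampling probability of the level left out. *)
Definition cost (m i : nat) : nat :=
  if i is j.+1 then if j is 0 then 40 else 3 * (m ^ i + 2 * rad m j) else 3.

(** Index [k] covers the levels 0 to [k.+1], whose shares [T / 2 ^+ i.+1] form a geometric sum.
    Levels 0 and 1 together are the base case, and [#|V|] pays for the forest. *)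
Lemma hierarchy (R : realFieldType) (m k : nat) (p N : nat -> R) (T : R) :
    (forall i, 0 < p i)%R -> (#|V|%:R <= N 0)%R -> (forall i, 2 * p i * N i <= N i.+1)%R ->
    (forall i, N i * (cost m i)%:R / p i <= T / 2 ^+ i.+1)%R ->
  exists (W : {set V}) F, [/\ (#|W|%:R <= N k.+2)%R, F \subset edges G,
    (#|F|%:R <= #|V|%:R + T * (1 - 1 / 2 ^+ k.+2))%R &
    approximates F W (m ^ k.+1) (rad m k.+1) (err m k.+1)].
Proof.
move=> p0 N0 NS NT.
have step i (U W : {set V}) : (#|U|%:R <= N i -> #|W|%:R <= 2 * p i * #|U|%:R ->
    #|W|%:R <= N i.+1)%R.
  by move=> UN WU; rewrite (le_trans WU) // (le_trans _ (NS i)) // ler_wpM2l // mulr_ge0 // ltW.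
have spent i (U : {set V}) : (#|U|%:R <= N i ->
    (cost m i)%:R * #|U|%:R / p i <= T / 2 ^+ i.+1)%R.
  move=> UN; apply: le_trans (NT i); rewrite ler_wpM2r ?invr_ge0 ?(ltW (p0 i)) //.
  by rewrite mulrC ler_wpM2r ?ler0n.
elim: k => [|k [W [F [Wc FG Fc HF]]]].
  have [V1 [W [F [Vc Wc FG Fc HF]]]] := first_level m (p0 0) (p0 1).
  have V1c : (#|V1|%:R <= N 1)%R by apply: (step 0 finset.setT); rewrite ?cardsT.
  exists W, F; rewrite expn1; split=> //; first exact: step Wc.
  have := spent 0 finset.setT; rewrite cardsT => /(_ N0) /= s0.
  have /= s1 := spent 1 _ V1c.
  move: s0 s1 Fc; rewrite !exprS expr0 !mulr1.
  by move: (T) => t; rewrite !invfM ?mul1r; lra.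
have [W' [F' [Wc' FG' Fc' HF']]] := next_level m (p0 k.+2) FG HF.
exists W', F'; split=> //; first exact: step Wc'.
have := spent k.+2 _ Wc.
have -> : (cost m k.+2)%:R%R = (3 * (m * m ^ k.+1 + 2 * rad m k.+1)%:R)%R :> R.
    by rewrite /cost natrM expnS.
move=> s; move: s Fc Fc'; rewrite [(2 ^+ k.+3)%R]exprS invfM !mul1r.
set x := ((2 ^+ k.+2)^-1)%R; set y := ((m * m ^ k.+1 + _)%:R)%R.
set w := (p k.+2)^-1%R; set t := (#|W|%:R)%R.
by rewrite (mulrAC 3%R y t); lra.
Qed.

(** A last set of fewer than one centre is empty, which rules out detours; segments can then be
    concatenated to any length. *)
Lemma spanner_of_sizes (R : realFieldType) (m k : nat) (p N : nat -> R) (T : R) :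
    (forall i, 0 < p i)%R -> (#|V|%:R <= N 0)%R -> (forall i, 2 * p i * N i <= N i.+1)%R ->
    (forall i, N i * (cost m i)%:R / p i <= T / 2 ^+ i.+1)%R -> (N k.+2 < 1)%R ->
    (0 <= T)%R ->
  exists F, [/\ F \subset edges G, (#|F|%:R <= #|V|%:R + T)%R &
    forall q n x y, (n <= q * m ^ k.+1)%N -> reach G n x y ->
      reach (spanned F) (n + q * err m k.+1) x y].
Proof.
move=> p0 N0 NS NT N1 T0.
have [W [F [Wc FG Fc HF]]] := hierarchy k p0 N0 NS NT.
exists F; split=> //.
  apply: (le_trans Fc); rewrite lerD2l ler_piMr // gerBl divr_ge0 // exprn_ge0 //.
have W0 : W = finset.set0.
  apply/eqP; rewrite -cards_eq0 -leqn0 -ltnS -(ltr_nat R).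
  exact: le_lt_trans Wc N1.
move=> q n x y nq xy; case: (approximates_concat HF nq xy) => //.
by case=> z [z' [a [b [c [e [e' [_ _ _ [/nearP[w]]]]]]]]]; rewrite W0 inE.
Qed.

End Hierarchy.

(** * Size of the hierarchy *)

Section Bounds.
Variable m : nat.
Hypothesis m5 : (5 <= m)%N.

Lemma rad_le i : (rad m i.+1 <= 3 * m ^ i.+1)%N.
Proof.
elim: i => [|i IH]; first by rewrite /= expn1; move: m5; clear; lia.
have -> : rad m i.+2 = (m ^ i.+2 + 3 * rad m i.+1)%N by [].
have : (5 * m ^ i.+1 <= m ^ i.+2)%N by rewrite [X in (_ <= X)%N]expnS leq_mul2r m5 orbT.
by move: IH; clear; lia.
Qed.

(** Each further level adds [4 * m + 36] to the bracket, since [rad m i.+2] is at most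
    [m ^ i.+2 + 9 * m ^ i.+1]. This is the source of the 4 in the additive term. The factor [m] on
    the left avoids a negative exponent. *)
Lemma err_le i : (m * err m i.+1 <= m ^ i * ((10 + 4 * i) * m + 36 * i))%N.
Proof.
case: i => [|i]; first by rewrite /= mul1n; clear; lia.
elim: i => [|i IH].
  by rewrite /= expn1 leq_mul2l; apply/orP; right; clear; lia.
have E : err m i.+3 = (m * err m i.+2 + 4 * rad m i.+2)%N by [].
have E2 : rad m i.+2 = (m ^ i.+2 + 3 * rad m i.+1)%N by [].
have h := rad_le i; have h2 : (rad m i.+2 <= m * m ^ i.+1 + 9 * m ^ i.+1)%N.
  by rewrite E2 [in leqLHS]expnS; move: h; clear; lia.
rewrite E [in leqRHS]expnS -mulnA leq_mul2l; apply/orP; right.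
by move: IH h2; set x := (m ^ i.+1)%N; clear; nia.
Qed.

(** The power of [m] in the price of a level: single edges at level 0 and path buying at level 1 pay
    none. *)
Definition level_exp (i : nat) : nat := if (i <= 1)%N then 0 else i.

Lemma cost_le i : (cost m i <= 40 * m ^ level_exp i)%N.
Proof.
case: i => [|[|i]] //.
have E : cost m i.+2 = (3 * (m ^ i.+2 + 2 * rad m i.+1))%N by [].
have -> : level_exp i.+2 = i.+2 by [].
rewrite E; have : (5 * m ^ i.+1 <= m ^ i.+2)%N by rewrite [X in (_ <= X)%N]expnS leq_mul2r m5 orbT.
by move: (rad_le i); clear; lia.
Qed.

End Bounds.

(** Exponent of 2 collected by the recursion [level_size], which squares at each step. *)
Fixpoint const_exp (i : nat) : nat := if i is j.+1 then 2 * const_exp j + j else 0.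

(** Exponent of the path length in [level_size]; at [k.+2] it is the numerator of [h_exp] at
    [k.+1]. *)
Fixpoint span_exp (i : nat) : nat := if i is j.+1 then 2 * span_exp j + level_exp j else 0.

Lemma const_expE i : (const_exp i + i + 1 = 2 ^ i)%N.
Proof. by elim: i => // i; rewrite expnS /= => <-; clear; lia. Qed.

Lemma span_exp_le i : (span_exp i <= const_exp i)%N.
Proof.
elim: i => //= i IH; apply: leq_add; first by rewrite leq_mul2l.
by rewrite /level_exp; case: ifP.
Qed.

Lemma span_expE k : (span_exp k.+2 + k.+3 = 3 * 2 ^ k)%N.
Proof.
elim: k => // k; have -> : span_exp k.+3 = (2 * span_exp k.+2 + k.+2)%N by [].
by rewrite expnS; lia.
Qed.

Section Sizes.
Local Open Scope ring_scope.
Variables (R : realFieldType) (n T a : R).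
Hypotheses (n0 : 0 < n) (T0 : 0 < T) (a1 : 1 <= a).
Variable r : R.
Hypothesis r0 : 0 < r.

(* This is [N_(i+1) = 2 p_i N_i], where the sampling probability
   [p_i = 80 2^i (a r)^(level_exp i) N_i / T] is the one with which level [i] costs
   at most [T / 2^(i+1)] edges. *)
Fixpoint level_size (i : nat) : R :=
  if i is j.+1 then level_size j ^+ 2 * (160 * 2 ^+ j * (a * r) ^+ level_exp j) / T else n.

Lemma level_size_gt0 i : 0 < level_size i.
Proof.
have ar : 0 < a * r by rewrite mulr_gt0 // (lt_le_trans ltr01).
elim: i => [//|i IH].
have c0 : 0 < 160 :> R by lra.
rewrite /=; apply: divr_gt0 => //; apply: mulr_gt0; first exact: exprn_gt0.
by apply: mulr_gt0; [apply: mulr_gt0 => //; exact: exprn_gt0|exact: exprn_gt0].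
Qed.

Lemma level_sizeE i : level_size i * T ^+ (2 ^ i - 1) =
  n ^+ (2 ^ i) * 160 ^+ (2 ^ i - 1) * 2 ^+ const_exp i * (a * r) ^+ span_exp i.
Proof.
elim: i => [|i IH]; first by rewrite subnn !expr0 expr1 !mulr1.
have E : (2 ^ i.+1 - 1 = (2 ^ i - 1) * 2 + 1)%N.
  by rewrite expnS; have := expn_gt0 2 i; lia.
transitivity ((level_size i * T ^+ (2 ^ i - 1)) ^+ 2 *
    (160 * 2 ^+ i * (a * r) ^+ level_exp i)).
  rewrite /= E exprD expr1 exprM exprMn; field; exact: lt0r_neq0.
have Ec : const_exp i.+1 = (const_exp i * 2 + i)%N by rewrite mulnC.
have Es : span_exp i.+1 = (span_exp i * 2 + level_exp i)%N by rewrite mulnC.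
rewrite IH E Ec Es expnS [(2 * 2 ^ i)%N]mulnC !exprD !exprM !exprMn expr1.
by ring.
Qed.

(** Both collected exponents are at most [2 ^ i - 1], so the powers of 2 and of [a >= 1] go into the
    constant. The exponent of [r] stays exact, being the one in the theorem. *)
Lemma level_size_le i : level_size i * T ^+ (2 ^ i - 1) <=
  n ^+ (2 ^ i) * (320 * a) ^+ (2 ^ i - 1) * r ^+ span_exp i.
Proof.
have ci : (const_exp i <= 2 ^ i - 1)%N by rewrite -const_expE; lia.
rewrite level_sizeE -!mulrA ler_pM2l ?exprn_gt0 // (_ : 320 * a = 160 * (2 * a)); last by ring.
rewrite [(160 * _) ^+ _]exprMn -!mulrA ler_pM2l ?exprn_gt0 //.
rewrite [(a * r) ^+ _]exprMn !mulrA ler_pM2r ?exprn_gt0 // exprMn.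
apply: ler_pM; rewrite ?exprn_ge0 // ?(le_trans ler01) //.
  by rewrite ler_eXn2l // ltr1n.
by rewrite ler_weXn2l // (leq_trans (span_exp_le i)).
Qed.

End Sizes.

(** * Choice of the parameters *)

Local Open Scope classical_set_scope.
Local Open Scope ring_scope.

Section Numeric.
Variable R : realType.

Lemma h_expE k : h_exp R k.+1 = (span_exp k.+2)%:R / (2 ^ k.+2 - 1)%:R.
Proof.
rewrite /h_exp /= natrB ?expn_gt0 // natrX; congr (_ / _).
by rewrite -natrX -natrM -span_expE natrD addrK.
Qed.

Lemma h_exp_lt k : (1 <= k)%N -> h_exp R k < 3 / 4.
Proof.
case: k => // k _; rewrite /h_exp /= !exprS -natr1.
have x1 : 1 <= 2 ^+ k :> R by rewrite exprn_ege1 // ler1n.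
have k0 : 0 <= k.+2%:R :> R by rewrite ler0n.
by rewrite ltr_pdivrMr; lra.
Qed.

(** Here [y ^+ 2 * k] is at least 1 for [k >= 1], so the second factor times [k] is at least
    [4 * k + (a - 4)]. The first factor tends to 1, yet its power [k - 1] outgrows a linear term. *)
Definition eta (a : R) (k : nat) : R :=
  let y := Num.sqrt (2 * harmonic k) in (1 + a * y) ^+ 2 * (4 + (a - 4) * y ^+ 2) - 4.

Lemma eta_cvg a : eta a k @[k --> \oo] --> (0 : R).
Proof.
have y0 : Num.sqrt (2 * harmonic k) @[k --> \oo] --> (0 : R).
  rewrite -[X in _ --> X](@sqrtr0 R) -[X in Num.sqrt X](mulr0 2).
  apply: continuous_cvg; first exact: sqrt_continuous.
  by apply: cvgMl_tmp; exact: cvg_harmonic.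
have p0 : (1 + a * (0 : R)) ^+ 2 * (4 + (a - 4) * 0 ^+ 2) - 4 = 0.
  by rewrite mulr0 addr0 expr1n mul1r expr0n mulr0 addr0 subrr.
rewrite -[X in _ --> X]p0 /eta.
apply: cvgB; last exact: cvg_cst.
apply: cvgM.
  under eq_fun do rewrite expr2.
  by rewrite expr2; apply: cvgM; (apply: cvgD; first exact: cvg_cst);
    apply: cvgM => //; exact: cvg_cst.
apply: cvgD; first exact: cvg_cst.
under eq_fun do rewrite expr2.
by rewrite expr2; apply: cvgM; [exact: cvg_cst|exact: cvgM].
Qed.

Lemma bernoulli_le (x : R) n : 0 <= x -> n%:R * x <= (1 + x) ^+ n.
Proof.
move=> x0; suff : 1 + n%:R * x <= (1 + x) ^+ n by lra.
elim: n => [|n IH]; first by rewrite mul0r addr0 expr0.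
rewrite exprS; apply: (@le_trans _ _ ((1 + x) * (1 + n%:R * x))).
  have : 0 <= n%:R * x ^+ 2 by rewrite mulr_ge0 ?sqr_ge0.
  by rewrite -natr1 expr2; lra.
by rewrite ler_wpM2l // addr_ge0.
Qed.

(* By Bernoulli's inequality [(1 + a y) ^ (2 k)] absorbs the factor [eps * m],
   which is of order [4 k]. *)
Lemma additive_bound (a eps : R) (k m : nat) : (0 < k)%N -> 8 <= a -> 0 < eps ->
    m%:R * eps <= 4 * k.+1%:R + (a - 4) ->
  eps * m%:R ^+ k.+1 <= ((4 + eta a k.+1) * k.+1%:R / eps) ^+ k.
Proof.
move=> k0 a8 e0 me; set s : R := 4 * k.+1%:R + (a - 4) in me *.
have K2 : 2 <= k.+1%:R :> R by rewrite ler_nat.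
have s0 : 0 < s by rewrite /s; lra.
pose y : R := Num.sqrt (2 * harmonic k.+1).
have y0 : 0 <= y by exact: sqrtr_ge0.
have yK : 1 <= y ^+ 2 * k.+1%:R.
  rewrite sqr_sqrtr ?mulr_ge0 ?invr_ge0 // /harmonic /= mulrAC.
  by rewrite ler_pdivlMr ?ltr0n // -[k.+2%:R]natr1; lra.
have -> : (4 + eta a k.+1) * k.+1%:R =
    (1 + a * y) ^+ 2 * (4 * k.+1%:R + (a - 4) * (y ^+ 2 * k.+1%:R)).
  by rewrite /eta -/y; ring.
have le1 : s <= 4 * k.+1%:R + (a - 4) * (y ^+ 2 * k.+1%:R).
  by rewrite lerD2l ler_peMr //; lra.
have ay0 : 0 <= a * y by rewrite mulr_ge0 //; lra.
have le2 : s <= ((1 + a * y) ^+ 2) ^+ k.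
  have b0 : 0 <= k%:R * (a * y) by rewrite mulr_ge0.
  rewrite -exprM mulnC exprM; apply: (@le_trans _ _ ((k%:R * (a * y)) ^+ 2)); last first.
    by rewrite lerXn2r ?nnegrE ?exprn_ge0 ?addr_ge0 // bernoulli_le.
  rewrite !exprMn.
  (* [k.+1 <= 2 * k] costs a factor 4 after squaring, which one of the two factors [a] absorbs. *)
  have hk : k.+1%:R ^+ 2 <= 4 * k%:R ^+ 2 :> R.
    have -> : 4 * k%:R ^+ 2 = (2 * k%:R) ^+ 2 :> R by rewrite exprMn; ring.
    rewrite lerXn2r ?nnegrE ?mulr_ge0 //.
    by have : 1 <= k%:R :> R; rewrite ?ler1n // -natr1; lra.
  have hs : s <= a * k.+1%:R by rewrite /s; nra.
  rewrite -(@ler_pM2r _ (k.+1%:R)) ?ltr0n //.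
  rewrite (_ : k%:R ^+ 2 * (a ^+ 2 * y ^+ 2) * k.+1%:R =
    (k%:R ^+ 2 * a ^+ 2) * (y ^+ 2 * k.+1%:R)); last by ring.
  apply: (@le_trans _ _ (k%:R ^+ 2 * a ^+ 2)); last first.
    by rewrite ler_peMr // mulr_ge0 // sqr_ge0.
  apply: (@le_trans _ _ (a * k.+1%:R ^+ 2)).
    by rewrite [X in _ <= _ * X]expr2 mulrA ler_wpM2r.
  rewrite [_ * a ^+ 2]mulrC [a ^+ 2]expr2 -mulrA ler_wpM2l //; first by lra.
  by apply: (le_trans hk); rewrite ler_wpM2r ?sqr_ge0 //; lra.
have mle : m%:R <= s / eps by rewrite ler_pdivlMr.
have sd : 0 <= s / eps by rewrite divr_ge0 // ltW.
have me0 : 0 <= m%:R * eps by rewrite mulr_ge0 // ltW.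
rewrite exprS mulrA [eps * _]mulrC.
apply: (@le_trans _ _ (s * (s / eps) ^+ k)).
  by apply: ler_pM => //; rewrite lerXn2r // nnegrE.
rewrite -[in leRHS]mulrA [in leRHS]exprMn; apply: ler_pM => //; [exact: ltW|exact: exprn_ge0|].
have le3 : s / eps <= (4 * k.+1%:R + (a - 4) * (y ^+ 2 * k.+1%:R)) / eps.
  by rewrite ler_wpM2r ?invr_ge0 // ltW.
by rewrite lerXn2r // nnegrE; exact: le_trans sd le3.
Qed.

(** Truncate the lower bound divided by [eps] and add 11: this rounds up, ensures [11 <= m], and
    raises [9 * eps0] to at most [20 * eps0]. *)
Lemma choose_base (eps0 eps : R) (k : nat) : 0 < eps -> eps <= eps0 ->
  exists m : nat, [/\ (11 <= m)%N, 4 * k.+1%:R + 10 + 9 * eps0 <= m%:R * eps,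
    m%:R * eps <= 4 * k.+1%:R + (10 + 20 * eps0) &
    m%:R <= (14 + 20 * eps0) * (k.+1%:R / eps)].
Proof.
move=> e0 ee; set x := 4 * k.+1%:R + 10 + 9 * eps0.
have K1 : 1 <= k.+1%:R :> R by rewrite ler1n.
have x0 : 0 <= x by rewrite /x; lra.
have xe0 : 0 <= x / eps by rewrite divr_ge0 // ltW.
have /andP[t1 t2] := truncn_itv xe0.
have h : (Num.truncn (x / eps))%:R * eps <= x by rewrite -ler_pdivlMr.
have h' : x <= ((Num.truncn (x / eps))%:R + 1) * eps.
  by rewrite -ler_pdivrMr // natr1 ltW.
have hm : (Num.truncn (x / eps) + 11)%:R * eps <= 4 * k.+1%:R + (10 + 20 * eps0).
  by rewrite natrD mulrDl; move: h; rewrite /x; lra.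
exists (Num.truncn (x / eps) + 11)%N; split=> //; first by rewrite leq_addl.
  by rewrite natrD; move: h' e0; rewrite !mulrDl; lra.
rewrite mulrA ler_pdivlMr //; apply: le_trans hm _.
have := K1; have : 0 <= eps0 by lra.
by set K := k.+1%:R; clear; nra.
Qed.

(** The term [36 * k] of [err_le] is paid by [9 * eps0 * m], because [m * eps0] exceeds [4 * k]. *)
Lemma err_small (eps0 eps : R) (k m : nat) : 0 < eps -> eps <= eps0 -> (11 <= m)%N ->
    4 * k.+1%:R + 10 + 9 * eps0 <= m%:R * eps ->
  (err m k.+1)%:R <= eps * m%:R ^+ k.+1.
Proof.
move=> e0 ee m11 hm; have m0 : 0 < m%:R :> R by rewrite ltr0n (leq_trans _ m11).
rewrite -(ler_pM2l m0) -natrM.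
apply: (@le_trans _ _ (m ^ k * ((10 + 4 * k) * m + 36 * k))%:R).
  by rewrite ler_nat err_le // (leq_trans _ m11).
rewrite natrM natrX (_ : m%:R * (eps * _) = m%:R ^+ k * ((m%:R * eps) * m%:R));
  last by rewrite exprS; move: (m%:R : R) => w; ring.
rewrite ler_pM2l ?exprn_gt0 //.
have hm2 : (4 * k.+1%:R + 10 + 9 * eps0) * m%:R <= m%:R * eps * m%:R by rewrite ler_pM2r.
rewrite !(natrD, natrM); move: hm hm2; rewrite -[k.+1%:R]natr1.
have k0 : 0 <= k%:R :> R by [].
have em : m%:R * eps <= m%:R * eps0 by rewrite ler_pM2l.
have e1 : 0 <= eps0 by lra.
by move: m0 k0 em; move: (m%:R : R) (k%:R : R) => x K x0 K0 h1 h2 h3; lra.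
Qed.

(** The ratio [r] may be below 1, but not below [1 / eps0]. In that case [r] to the power [h_exp] is
    at least [r], and the [eps0] in the constant makes up for it. *)
Lemma size_base (eps0 eps n : R) (k : nat) : 0 < eps -> eps <= eps0 -> 1 <= n ->
  n <= 640 * (14 + 20 * eps0) * (k.+1%:R / eps) `^ h_exp R k.+1 * n `^ edge_exp R k.+1.
Proof.
move=> e0 ee n1; set r := k.+1%:R / eps.
have K1 : 1 <= k.+1%:R :> R by rewrite ler1n.
have r0 : 0 < r by rewrite divr_gt0 // ltr0n.
have er : 1 <= eps0 * r by rewrite /r mulrA ler_pdivlMr // mul1r; nra.
have M0 : 0 < (2 ^ k.+2 - 1)%:R :> R.
  by rewrite ltr0n subn_gt0 -{1}(expn0 2) ltn_exp2l.
have h0 : 0 <= h_exp R k.+1 by rewrite h_expE divr_ge0 // ltW.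
have h1 : h_exp R k.+1 <= 1 by have := @h_exp_lt k.+1 isT; lra.
have rh : 1 <= 640 * (14 + 20 * eps0) * r `^ h_exp R k.+1.
  case: (leP 1 r) => r1.
    have := ler_powR r1 h0; rewrite powRr0; nra.
  have := @ger_powR _ r _ _ _ h1; rewrite r0 (ltW r1) powRr1 ?(ltW r0) //.
  by move=> /(_ isT); nra.
rewrite -[X in X <= _]mul1r; apply: ler_pM => //; first by lra.
rewrite -[X in X <= _]powRr1; last by lra.
by apply: ler_powR => //; rewrite lerDl divr_ge0 // subr_ge0 exprn_ege1 // ler1n.
Qed.

(** Raised to the power [2 ^ k.+2 - 1], [T] has the same exponents of [n] and [r] as the bound of
    [level_size_le]; 640 against 320 makes the inequality strict. *)
Lemma level_size_lt1 (eps0 eps n : R) (k : nat) : 0 < eps -> eps <= eps0 -> 1 <= n ->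
  level_size n (640 * (14 + 20 * eps0) * (k.+1%:R / eps) `^ h_exp R k.+1
      * n `^ edge_exp R k.+1) (14 + 20 * eps0) (k.+1%:R / eps) k.+2 < 1.
Proof.
move=> e0 ee n1; set a := 14 + 20 * eps0; set r := k.+1%:R / eps; set T := _ * _ * _.
have a1 : 1 <= a by rewrite /a; lra.
have a0 : 0 < a by lra.
have n0 : 0 < n by lra.
have r0 : 0 < r by rewrite divr_gt0 // ltr0n.
have T0 : 0 < T.
  apply: mulr_gt0; last exact: powR_gt0.
  by apply: mulr_gt0; [lra|exact: powR_gt0].
pose M := (2 ^ k.+2 - 1)%N.
have M0 : (0 < M)%N by rewrite subn_gt0 -{1}(expn0 2) ltn_exp2l.
have MR0 : M%:R != 0 :> R by rewrite pnatr_eq0 -lt0n.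
have TM : T ^+ M = n ^+ (2 ^ k.+2) * (640 * a) ^+ M * r ^+ span_exp k.+2.
  have split3 (x y z : R) : (x * y * z) ^+ M = x ^+ M * y ^+ M * z ^+ M.
    by rewrite !exprMn.
  rewrite /T split3 -(powR_mulrn _ (powR_ge0 r _)) -(powR_mulrn _ (powR_ge0 n _)).
  rewrite -!powRrM h_expE -/M divfK // powR_mulrn ?(ltW r0) //.
  have -> : edge_exp R k.+1 * M%:R = (2 ^ k.+2)%:R.
    rewrite /edge_exp; have -> : 2 ^+ k.+2 - 1 = M%:R :> R.
      by rewrite /M natrB ?expn_gt0 // natrX.
    rewrite mulrDl divfK // mul1r natr1; congr (_%:R).
    by rewrite /M subn1 prednK // expn_gt0.
  by rewrite powR_mulrn ?(ltW n0) // mulrC mulrA.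
rewrite -(ltr_pM2r (exprn_gt0 M T0)) mul1r.
apply: (le_lt_trans (level_size_le n0 T0 a1 r0 k.+2)); rewrite -/M TM.
rewrite ltr_pM2r ?exprn_gt0 // ltr_pM2l ?exprn_gt0 //.
by rewrite ltrXn2r ?nnegrE ?mulr_ge0 ?(ltW a0) ?gtn_eqF // ltr_pM2r // ltr_nat.
Qed.

End Numeric.

(** * Distances as extended reals and the final spanner *)

Section Distances.
Variables (R : realType) (V : finType) (G : sgraph V).

Lemma gdist_le n u v : reach G n u v -> (gdist R G u v <= n%:R%:E)%E.
Proof.
case/reachP => p [pp pl ps]; apply: (@le_trans _ _ (size p)%:R%:E).
  by apply: ereal_inf_lbound; exists p.
by rewrite lee_fin ler_nat.
Qed.

Lemma gdistP u v :
  (exists2 n, reach G n u v & gdist R G u v = n%:R%:E) \/ gdist R G u v = +oo%E.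
Proof.
case: (EM (exists n, reach G n u v)) => [ex|no].
  left; case: (ex_minnP ex) => n rn nmin; exists n => //.
  apply/eqP; rewrite eq_le gdist_le //=; apply/ereal_infP => y [p [pp pl] <-].
  by rewrite lee_fin ler_nat; apply: nmin; apply/reachP; exists p.
right; apply/eqP; rewrite -leye_eq; apply/ereal_infP => y [p [pp pl] _].
by case: no; exists (size p); apply/reachP; exists p.
Qed.

End Distances.

Lemma spanner_edges (R : realType) (eps0 eps : R) (k : nat) (V : finType) (G : sgraph V) :
    0 < eps -> eps <= eps0 -> (0 < #|V|)%N ->
  exists F : {set {set V}}, [/\ F \subset edges G,
    #|F|%:R <= 1280 * (14 + 20 * eps0) * (k.+1%:R / eps) `^ h_exp R k.+1
      * #|V|%:R `^ edge_exp R k.+1 &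
    forall n u v, reach G n u v -> exists2 l : nat, reach (spanned F) l u v &
      l%:R <= (1 + eps) * n%:R + additive_term 6 (eta (14 + 20 * eps0)) k.+1 eps].
Proof.
move=> e0 ee V0; set a := 14 + 20 * eps0; set r := k.+1%:R / eps.
set n := #|V|%:R.
have n1 : 1 <= n by rewrite ler1n.
have n0 : 0 < n by lra.
have a1 : 1 <= a by rewrite /a; lra.
have r0 : 0 < r by rewrite divr_gt0 // ltr0n.
have ar0 : 0 < a * r by rewrite mulr_gt0 //; lra.
have nT := size_base k e0 ee n1; have Nlt := level_size_lt1 k e0 ee n1.
move: nT Nlt; rewrite -/a -/r; set T := 640 * a * _ * _ => nT Nlt.
have T0 : 0 < T by lra.
have [m [m11 hm1 hm2 mr]] := choose_base k e0 ee.
pose N := level_size n T a r.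
have N0 i : 0 < N i by exact: level_size_gt0.
pose w i : R := 80 * 2 ^+ i * (a * r) ^+ level_exp i.
have w0 i : 0 < w i by rewrite mulr_gt0 ?exprn_gt0 // mulr_gt0 ?exprn_gt0.
have [|||F [FG Fc HF]] := @spanner_of_sizes V G R m k (fun i => N i * w i / T) N T
  _ (lexx n) _ _ Nlt (ltW T0).
- by move=> i; rewrite divr_gt0 // mulr_gt0.
- move=> i; rewrite (_ : N i.+1 = 2 * (N i * w i / T) * N i) //.
  by rewrite /N /= -/(N i) /w; ring.
- move=> i; have -> : N i * (cost m i)%:R / (N i * w i / T) = (cost m i)%:R * T / w i.
    by have := N0 i; have := w0 i => *; field; rewrite !lt0r_neq0.
  rewrite ler_pdivrMr // exprS (_ : T / (2 * 2 ^+ i) * w i = 40 * (a * r) ^+ level_exp i * T).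
    rewrite ler_pM2r // (@le_trans _ _ (40 * m ^ level_exp i)%:R) //.
      by rewrite ler_nat cost_le // (leq_trans _ m11).
    have mr' : m%:R <= a * r by [].
    have ar1 : 0 <= a * r by exact: ltW.
    by rewrite natrM natrX ler_pM2l ?ltr0n // lerXn2r ?nnegrE ?ler0n.
  have p0 : 2 ^+ i != 0 :> R by rewrite expf_neq0.
  by rewrite /w; field.
exists F; split=> //.
  (* The term [#|V|] is at most [T], so 640 doubles to 1280. *)
  apply: (le_trans Fc); apply: (@le_trans _ _ (T + T)); first by rewrite lerD2r.
  by rewrite /T; lra.
move=> d u v uv; have small := err_small e0 ee m11 hm1.
have mK : (0 < m ^ k.+1)%N by rewrite expn_gt0 (leq_trans _ m11).
(* One piece beyond the full ones: its error is the additive term, while the full pieces err by at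
   most [eps * d] in total. *)
have dq : (d <= (d %/ m ^ k.+1).+1 * m ^ k.+1)%N by rewrite ltnW // ltn_ceil.
exists (d + (d %/ m ^ k.+1).+1 * err m k.+1)%N; first exact: HF uv.
have add : (err m k.+1)%:R <= additive_term 6 (eta a) k.+1 eps.
  (* For the first exponent the error is [err m 1 = 6], the constant [A]. *)
  rewrite /additive_term eqSS; case: posnP => [->|k0]; first exact: lexx.
  apply: (le_trans small); apply: additive_bound => //.
    by rewrite /a; lra.
  by apply: le_trans hm2 _; rewrite /a; lra.
rewrite mulSn natrD natrD mulrDl mul1r -addrA lerD2l addrC lerD // natrM.
apply: (@le_trans _ _ ((d %/ m ^ k.+1)%:R * (eps * m%:R ^+ k.+1))).
  by rewrite ler_wpM2l.
rewrite mulrCA ler_pM2l // -natrX -natrM ler_nat; exact: leq_divM.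
Qed.

Theorem theorem3 (R : realType) :
  (forall k : nat, (1 <= k)%N -> h_exp R k < 3 / 4) /\
  exists A : R, forall eps0 : R, 0 < eps0 ->
  exists (C : R) (eta : nat -> R),
    eta k @[k --> \oo] --> (0 : R) /\
    forall (k : nat) (eps : R) (V : finType) (G : sgraph V),
      (1 <= k)%N -> 0 < eps -> eps <= eps0 ->
      exists H : sgraph V,
        [/\ subgraph H G,
            #|edges H|%:R <= C * (k%:R / eps) `^ (h_exp R k) * #|V|%:R `^ (edge_exp R k)
          & forall u v : V,
              (gdist R H u v <= (1 + eps)%:E * gdist R G u v
                               + (additive_term A eta k eps)%:E)%E].
Proof.
split; first exact: h_exp_lt.
exists 6 => eps0 eps00; exists (1280 * (14 + 20 * eps0)), (eta (14 + 20 * eps0)).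
split; first exact: eta_cvg.
(* Without vertices [G] serves as its own spanner; the size estimates start from [#|V| >= 1]. *)
case=> // k eps V G _ e0 ee; case: (posnP #|V|) => [V0|V0].
  exists G; split=> [x y //||u]; last by have := card0_eq V0 u.
  have -> : edges G = finset.set0.
    apply/setP => e; rewrite inE; apply/negP => /imsetP[[x y] _ _].
    by have := card0_eq V0 x.
  rewrite cards0; apply: mulr_ge0; last exact: powR_ge0.
  by apply: mulr_ge0; [lra|exact: powR_ge0].
have [F [FG Fc HF]] := spanner_edges k G e0 ee V0.
have Firr : irreflexive (spanned F).
  by move=> x; apply/negP => /(spanned_edges FG); rewrite adj_irr.
pose H := SGraph (@spanned_sym V F) Firr; exists H; split.
- exact: spanned_edges.
- apply: le_trans Fc; rewrite ler_nat; apply: subset_leq_card.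
  by apply/fintype.subsetP => e /imsetP[[x y]]; rewrite inE /= => xy ->.
- move=> u v; case: (gdistP R G u v) => [[n rn ->]|->]; last first.
    by rewrite gt0_muley ?lte_fin ?addr_gt0 // addye // leey.
  have [l rl ll] := HF _ _ _ rn.
  by apply: (le_trans (@gdist_le R V H l u v rl)); rewrite -EFinM -EFinD lee_fin.
Qed.
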